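(* For a given $\bar\alpha\in\Delta^n$, the upper-bound condition $$q_{\bar\alpha}(\beta,x)\le h(\bar\alpha)\qquad\text{for every }\beta\in\Delta^n\text{ and every }x\in z^*(\beta)$$ holds if and only if $$(1-\lambda)m_x+\lambda U(\bar\alpha,x)\le h(\bar\alpha)\qquad\text{for every }x\in X^I.$$ When it holds, define $$I(\bar\alpha)=\{x\in X^I:(1-\lambda)m_x+\lambda U(\bar\alpha,x)=h(\bar\alpha)\}.$$ Then $$K(\bar\alpha)=\bigcup_{x\in I(\bar\alpha)}F_x.$$ In particular, both the upper-bound condition and exclusion of all pure worldviews from its equality set $K(\bar\alpha)$ have finite descriptions in the primitive payoffs.
   Context: $J=\{1,\ldots,n\}$ and $X$ are nonempty finite sets (pure worldviews and actions, respectively), with primitive payoffs $u_j(x)\in\mathbb R$ for $j\in J$, $x\in X$. $\Delta^n=\{\alpha\in\mathbb R^n:\alpha^j\ge0,\ \sum_j\alpha^j=1\}$ is the set of worldviews; the pure worldviews are its vertices $\alpha(1),\ldots,\alpha(n)$, where $\alpha(j)$ puts weight one on $j$. $U(\alpha,x)=\sum_j\alpha^ju_j(x)$, $z^*(\alpha)=\arg\max_{x\in X}U(\alpha,x)$, $h(\alpha)=\max_{x\in X}U(\alpha,x)$, and $X^I=\bigcup_{\alpha\in\Delta^n}z^*(\alpha)$ is the set of implementable actions. Fix $0<\lambda<1$. Define $q_{\bar\alpha}(\beta,x)=(1-\lambda)U(\beta,x)+\lambda U(\bar\alpha,x)$ and the equality set $K(\bar\alpha)=\{\beta\in\Delta^n:\exists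 x\in z^*(\beta)\text{ with }q_{\bar\alpha}(\beta,x)=h(\bar\alpha)\}$. For each $x\in X^I$ let $$C_x=\{\beta\in\Delta^n:x\in z^*(\beta)\},\quad m_x=\max_{\beta\in C_x}U(\beta,x),\quad F_x=\arg\max_{\beta\in C_x}U(\beta,x).$$ Each $C_x$ is a nonempty compact polytope, so $m_x$ is the value of a linear program and $F_x$ is a nonempty exposed face of $C_x$, possibly the whole polytope. *)

(* Defs.v *)
From HB Require Import structures.
From mathcomp Require Import all_boot all_order all_algebra.
From mathcomp Require Import all_classical all_reals all_analysis.
From mathcomp Require Import ordered_qelim.

Set Implicit Arguments.
Unset Strict Implicit.
Unset Printing Implicit Defensive.

Import Order.TTheory GRing.Theory Num.Theory.
Import numFieldNormedType.Exports.

Local Open Scope classical_set_scope.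
Local Open Scope ring_scope.

Section Argmax.
Context {R : realType} {T : Type}.
Implicit Types (A : set T) (f : T -> R).

Definition argmax A f : set T := [set a | A a /\ forall b, A b -> f b <= f a].

(* The supremum; it is the maximum as soon as the maximum is attained
   (max_value_argmax), which is the case for every use below (argmax_fin,
   face_nonempty). *)
Definition max_value A f : R := sup (f @` A).

Lemma max_value_argmax A f a : argmax A f a -> max_value A f = f a.
Proof.
move=> [Aa maxa]; have ub : ubound (f @` A) (f a) by move=> _ [b Ab <-]; exact: maxa.
apply/eqP; rewrite eq_le; apply/andP; split.
  by apply: ge_sup => //; exists (f a), a.
by apply: ub_le_sup; [exists (f a) | exists a].
Qed.

End Argmax.

Lemma argmax_fin {R : realType} (X : finType) (f : X -> R) :
  (0 < #|X|)%N -> argmax setT f !=set0.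
Proof.
move=> /card_gt0P[x0 _]; exists [arg max_(x > x0) f x]%O.
by case: arg_maxP => // x _ maxx; split=> // y _; exact: maxx.
Qed.

Section Worldviews.
Context {R : realType} {n : nat} {X : finType}.
Implicit Types (u : 'I_n -> X -> R) (lambda : R) (alpha beta : 'rV[R]_n).

Definition worldviews : set 'rV[R]_n :=
  [set alpha | (forall j, 0 <= alpha 0 j) /\ \sum_j alpha 0 j = 1].

Definition pure_worldview (j : 'I_n) : 'rV[R]_n := delta_mx 0 j.

Definition payoff u alpha (x : X) : R := \sum_j alpha 0 j * u j x.

Definition optimal u alpha : set X := argmax setT (payoff u alpha).

Definition best_payoff u alpha : R := max_value setT (payoff u alpha).

Definition implementable u : set X := \bigcup_(alpha in worldviews) optimal u alpha.

Definition mixed_payoff u lambda alpha beta (x : X) : R :=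
  (1 - lambda) * payoff u beta x + lambda * payoff u alpha x.

Definition equality_set u lambda alpha : set 'rV[R]_n :=
  [set beta | worldviews beta /\
     exists2 x, optimal u beta x &
       mixed_payoff u lambda alpha beta x = best_payoff u alpha].

Definition cell u (x : X) : set 'rV[R]_n :=
  [set beta | worldviews beta /\ optimal u beta x].

Definition cell_max u (x : X) : R := max_value (cell u x) (payoff u ^~ x).

Definition face u (x : X) : set 'rV[R]_n := argmax (cell u x) (payoff u ^~ x).

Definition upper_bound u lambda alpha : Prop :=
  forall beta, worldviews beta -> forall x, optimal u beta x ->
    mixed_payoff u lambda alpha beta x <= best_payoff u alpha.

Definition tight u lambda alpha : set X :=
  [set x | implementable u x /\
     (1 - lambda) * cell_max u x + lambda * payoff u alpha x = best_payoff u alpha].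

Definition excludes_pure u lambda alpha : Prop :=
  forall j, ~ equality_set u lambda alpha (pure_worldview j).

(* Environment in which formulas are evaluated: variable 0 is lambda, the next
   n variables are the coordinates of alpha, and the remaining ones are the
   primitive payoffs. *)
Definition data u lambda alpha : seq R :=
  lambda :: [seq alpha 0 j | j <- enum 'I_n]
         ++ [seq u j x | j <- enum 'I_n, x <- enum X].

(* On the domain D, the condition P on the data of a problem with n pure
   worldviews and action set X is equivalent to a single finite Boolean
   combination of polynomial equations and inequalities in these data:
   qf_form excludes quantifiers and rformula excludes inverses.  The formula is
   chosen before the data; otherwise the notion would be void. *)
Definition finitely_described
    (D P : ('I_n -> X -> R) -> R -> 'rV[R]_n -> Prop) : Prop :=
  exists phi : ord.formula R,
    [/\ ord.qf_form phi, ord.rformula phi &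
        forall u lambda alpha, D u lambda alpha ->
          (P u lambda alpha <-> ord.holds (data u lambda alpha) phi)].

Lemma coordinate_continuous j : continuous (fun alpha : 'rV[R]_n => alpha 0 j).
Proof. exact: coord_continuous. Qed.

Lemma payoff_continuous u x : continuous (payoff u ^~ x).
Proof.
rewrite /payoff => alpha; apply: (@continuous_big _ _ +%R) => //.
  exact: add_continuous.
move=> j _ a.
exact: (@cvgM _ _ (nbhs a) _ _ _ _ _ (@coordinate_continuous j a) (cvg_cst _)).
Qed.

Lemma worldviews_compact : compact worldviews.
Proof.
have -> : worldviews = (\bigcap_(j in [set: 'I_n]) [set a : 'rV[R]_n | 0 <= a 0 j])
    `&` [set a | \sum_j a 0 j = 1].
  by apply/seteqP; split=> a [a0 a1]; split=> // j *; exact: a0.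
apply: bounded_closed_compact.
  exists 1; split=> // M M1 a [a0 a1]; apply: le_trans (ltW M1).
  rewrite [`|a|]mx_normrE; apply/bigmax_leP; split=> // -[i j] _ /=.
  rewrite ord1 ger0_norm; last exact: a0.
  rewrite -a1 (bigD1 j) //= lerDl sumr_ge0 // => k _; exact: a0.
apply: closedI.
  apply: closed_bigI => j _.
  apply: (@preimage_closed _ _ (fun a : 'rV[R]_n => a 0 j) [set y | 0 <= y]).
    by move=> a _; exact: coordinate_continuous.
  exact: closed_ge.
apply: (@preimage_closed _ _ (fun a : 'rV[R]_n => \sum_j a 0 j) [set y | y = 1]).
  move=> a _; apply: (@continuous_big _ _ +%R) => //.
    exact: add_continuous.
  by move=> j _; exact: coordinate_continuous.
exact: closed_eq.
Qed.

Lemma cell_compact u x : compact (cell u x).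
Proof.
have -> : cell u x = worldviews `&`
    \bigcap_(y in [set: X]) [set a | 0 <= payoff u a x - payoff u a y].
  apply/seteqP; split=> a [wa].
    by move=> [_ za]; split=> // y _ /=; rewrite subr_ge0 za.
  by move=> za; split=> //; split=> // y _; have /= := za y I; rewrite subr_ge0.
apply: compact_closedI; first exact: worldviews_compact.
apply: closed_bigI => y _.
apply: (@preimage_closed _ _ (fun a : 'rV[R]_n => payoff u a x - payoff u a y)
  [set r | 0 <= r]).
  move=> a _; exact: (@cvgB _ _ _ (nbhs a) _ _ _ _ _
    (@payoff_continuous u x a) (@payoff_continuous u y a)).
exact: closed_ge.
Qed.

Lemma face_nonempty u x : implementable u x -> face u x !=set0.
Proof.
move=> [a wa za].
have [|c /set_mem cc maxc] := EVT_max_rV _ (cell_compact (u := u) (x := x))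
    (continuous_subspaceT (@payoff_continuous u x)); first by exists a.
by exists c; split=> // b cb; apply: maxc; exact: mem_set.
Qed.

End Worldviews.

(* Main.v *)
Require Import Defs.
From HB Require Import structures.
From mathcomp Require Import all_boot all_order all_algebra.
From mathcomp Require Import all_classical all_reals all_analysis.
From mathcomp Require Import ordered_qelim.
From mathcomp Require qe_rcf.

Set Implicit Arguments.
Unset Strict Implicit.
Unset Printing Implicit Defensive.

Import Order.TTheory GRing.Theory Num.Theory.
Local Open Scope classical_set_scope.
Local Open Scope ring_scope.

(** The maximum of [U(beta, x)] over the compact cell [C_x] is attained exactly on
    [F_x], and the upper-bound condition on [C_x] only constrains that maximum:
    this gives the first equivalence, and equality can occur only at the maximum,
    on [F_x], which gives the formula for [K].  The upper-bound condition is a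
    first-order statement about the data whose only quantifiers range over the
    coordinates of [beta], so quantifier elimination over real closed fields gives
    its finite description.  For the exclusion of pure worldviews, [beta] is a
    vertex and no quantifier remains. *)

(** The language of formulas has no term for the maximum [h]. An upper bound by [h] is therefore
    traded for a disjunction over the actions, and dually a lower bound by [h] for a conjunction. *)
Lemma exists_le_max_value {R : realType} {X : finType} (f : X -> R) (c : R) :
  (0 < #|X|)%N -> c <= max_value setT f <-> exists x, c <= f x.
Proof.
move=> X_gt0; have [x maxx] := argmax_fin f X_gt0.
rewrite (max_value_argmax maxx); split=> [cx|[y cy]]; first by exists x.
by apply: le_trans cy _; case: maxx => _; apply.
Qed.

Lemma max_value_le {R : realType} {X : finType} (f : X -> R) (c : R) :
  (0 < #|X|)%N -> max_value setT f <= c <-> forall x, f x <= c.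
Proof.
move=> X_gt0; have [x maxx] := argmax_fin f X_gt0.
rewrite (max_value_argmax maxx); split=> [xc y|]; last exact.
by apply: le_trans xc; case: maxx => _; apply.
Qed.

(** * Cells, their maximal faces and the equality set *)

Section Cells.
Context {R : realType} {n : nat} {X : finType}.
Implicit Types (u : 'I_n -> X -> R) (lambda : R) (alpha beta : 'rV[R]_n).

Lemma pure_worldview_mem (j : 'I_n) : worldviews (pure_worldview j : 'rV[R]_n).
Proof.
split=> [k|]; first by rewrite mxE ler0n.
rewrite (bigD1 j) //= big1 => [|k /negPf kj]; last by rewrite mxE kj andbF.
by rewrite mxE !eqxx addr0.
Qed.

Lemma payoff_pure u j x : payoff u (pure_worldview j) x = u j x.
Proof.
rewrite /payoff (bigD1 j) //= big1 => [|k /negPf kj]; last first.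
  by rewrite mxE kj andbF mul0r.
by rewrite mxE !eqxx mul1r addr0.
Qed.

Lemma optimalP u beta x :
  optimal u beta x <-> forall y, payoff u beta y <= payoff u beta x.
Proof. by split=> [[_ max] y|max]; [exact: max | split]. Qed.

Lemma cell_implementable u beta x : cell u x beta -> implementable u x.
Proof. by move=> [wb zb]; exists beta. Qed.

Lemma payoff_le_cell_max u beta x :
  cell u x beta -> payoff u beta x <= cell_max u x.
Proof.
move=> cb; have [c fc] := face_nonempty (cell_implementable cb).
by rewrite /cell_max (max_value_argmax fc); apply: fc.2.
Qed.

Lemma faceP u beta x :
  face u x beta <-> cell u x beta /\ payoff u beta x = cell_max u x.
Proof.
split=> [fb|[cb eb]].
  by rewrite /cell_max (max_value_argmax fb); split=> //; exact: fb.1.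
by split=> // c cc; rewrite eb payoff_le_cell_max.
Qed.

Lemma mixed_payoff_le u lambda alpha beta x : lambda < 1 -> cell u x beta ->
  mixed_payoff u lambda alpha beta x <=
  (1 - lambda) * cell_max u x + lambda * payoff u alpha x.
Proof.
move=> lambda1 cb; rewrite lerD2r ler_wpM2l ?payoff_le_cell_max //.
by rewrite subr_ge0 ltW.
Qed.

Lemma upper_boundP u lambda alpha : lambda < 1 ->
  upper_bound u lambda alpha <->
  forall x, implementable u x ->
    (1 - lambda) * cell_max u x + lambda * payoff u alpha x <= best_payoff u alpha.
Proof.
move=> lambda1; split=> [ub x /face_nonempty[b /faceP[[wb zb] <-]]|ub b wb x zb].
  exact: ub.
have cb : cell u x b by [].
exact: le_trans (mixed_payoff_le alpha lambda1 cb) (ub x (cell_implementable cb)).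
Qed.

Lemma equality_set_faces u lambda alpha : lambda < 1 ->
  upper_bound u lambda alpha ->
  equality_set u lambda alpha = \bigcup_(x in tight u lambda alpha) face u x.
Proof.
move=> lambda1 /(upper_boundP u alpha lambda1) ub; apply/seteqP; split=> b.
  move=> [wb [x zb eb]]; have cb : cell u x b by [].
  have ix := cell_implementable cb.
  have tx : (1 - lambda) * cell_max u x + lambda * payoff u alpha x =
      best_payoff u alpha.
    by apply/eqP; rewrite eq_le ub //= -eb mixed_payoff_le.
  (* The two equalities with [h] differ only in the term weighted by [1 - lambda], which is nonzero
     since [lambda < 1]; cancelling it leaves the equality of the payoff with [m_x]. *)
  exists x => //; apply/faceP; split=> //; apply: (@mulfI _ (1 - lambda)).
    by rewrite subr_eq0 gt_eqF.
  by apply: (addIr (lambda * payoff u alpha x)); rewrite tx -eb.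
move=> [x [ix tx] /faceP[[wb zb] eb]]; split=> //; exists x => //.
by rewrite /mixed_payoff eb.
Qed.

(** At the vertex [j] the payoff of [x] is [u j x], so lying in the face of a tight action reduces
    to finitely many comparisons of primitive payoffs and one equation with the linear-programming
    value [m_x]. *)
Lemma excludes_pureP u lambda alpha : lambda < 1 ->
  upper_bound u lambda alpha ->
  excludes_pure u lambda alpha <->
  forall x j, tight u lambda alpha x ->
    ~ ((forall y, u j y <= u j x) /\ u j x = cell_max u x).
Proof.
move=> lambda1 ub; rewrite /excludes_pure (equality_set_faces lambda1 ub).
split=> [ex x j tx [uj ej]|ex j [x tx /faceP[[_ /optimalP zj] ej]]].
  apply: (ex j); exists x => //; apply/faceP; rewrite payoff_pure; split=> //.
  split; first exact: pure_worldview_mem.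
  by apply/optimalP => y; rewrite !payoff_pure.
apply: (ex x j tx); rewrite -ej payoff_pure; split=> // y.
by have := zj y; rewrite !payoff_pure.
Qed.

End Cells.

(** * Finite connectives, blocks of quantifiers and their elimination *)

Section Formulas.
Context {R : realType}.
Implicit Types (e : seq R) (f : ord.formula R) (t : GRing.term R).

Definition all_form {I : finType} (F : I -> ord.formula R) :=
  \big[ord.And/ord.Bool true]_i F i.

Definition some_form {I : finType} (F : I -> ord.formula R) :=
  \big[ord.Or/ord.Bool false]_i F i.

Definition sum_term {I : finType} (t : I -> GRing.term R) :=
  \big[GRing.Add/GRing.NatConst R 0]_i t i.

Definition forall_vars (i m : nat) f := foldr ord.Forall f (iota i m).

Lemma holds_le e t t' :
  ord.holds e (ord.Le t t') = (GRing.eval e t <= GRing.eval e t') :> Prop.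
Proof. by []. Qed.

Lemma holds_eq e t t' :
  ord.holds e (ord.Equal t t') = (GRing.eval e t = GRing.eval e t') :> Prop.
Proof. by []. Qed.

Lemma holds_all_form {I : finType} (F : I -> ord.formula R) e :
  ord.holds e (all_form F) <-> forall i, ord.holds e (F i).
Proof.
(* Restricting the quantifier to the list under the big operator makes induction on an arbitrary
   list possible. *)
have -> : (forall i, ord.holds e (F i)) <->
    {in index_enum I, forall i, ord.holds e (F i)}.
  by split=> h i //; apply: h; rewrite mem_index_enum.
rewrite /all_form; elim: (index_enum I) => [|i r IHr]; first by rewrite big_nil.
rewrite big_cons /= IHr; split=> [[hi hr] k|h].
  by rewrite inE => /predU1P[->//|]; exact: hr.
by split=> [|k kr]; apply: h; rewrite inE ?eqxx ?kr ?orbT.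
Qed.

Lemma holds_some_form {I : finType} (F : I -> ord.formula R) e :
  ord.holds e (some_form F) <-> exists i, ord.holds e (F i).
Proof.
have -> : (exists i, ord.holds e (F i)) <->
    exists2 i, i \in index_enum I & ord.holds e (F i).
  by split=> [[i hi]|[i _ hi]]; exists i; rewrite ?mem_index_enum.
rewrite /some_form; elim: (index_enum I) => [|i r IHr].
  by rewrite big_nil; split=> // -[].
rewrite big_cons /= IHr; split=> [[hi|[k kr hk]]|[k]].
- by exists i; rewrite ?inE ?eqxx.
- by exists k; rewrite ?inE ?kr ?orbT.
by rewrite inE => /predU1P[->|kr] hk; [left | right; exists k].
Qed.

Lemma eval_sum_term {I : finType} (t : I -> GRing.term R) e :
  GRing.eval e (sum_term t) = \sum_i GRing.eval e (t i).
Proof. exact: (big_morph (GRing.eval e)). Qed.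

(** The quantified variables start exactly at [size e], so each assignment appends a value to the
    environment and neither overwrites an entry nor pads with defaults. *)
Lemma holds_forall_vars e f m :
  ord.holds e (forall_vars (size e) m f) <->
  forall s : m.-tuple R, ord.holds (e ++ s) f.
Proof.
rewrite /forall_vars; elim: m e => [|m IHm] e /=.
  by split=> [h s|/(_ [tuple])]; rewrite ?tuple0 cats0.
(* Writing at position [size e] is [rcons], so the induction hypothesis applies to an environment
   longer by one, where the next variable is again the first free one. *)
have step x : ord.holds (set_nth 0 e (size e) x)
      (foldr ord.Forall f (iota (size e).+1 m)) <->
    forall s : m.-tuple R, ord.holds (e ++ x :: s) f.
  have -> : set_nth 0 e (size e) x = rcons e x.
    by rewrite set_nthE ltnn subnn cats1.
  by rewrite -(size_rcons e x) IHm; under eq_forall do rewrite cat_rcons.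
split=> [h s|h x].
  by case/tupleP: s => x s; exact: (iffLR (step x) (h x) s).
by apply/step => s; have := h [tuple of x :: s].
Qed.

Lemma all_form_rformula {I : finType} (F : I -> ord.formula R) :
  (forall i, ord.rformula (F i)) -> ord.rformula (all_form F).
Proof.
by move=> rF; apply: (big_ind (fun f => is_true (ord.rformula f))) => //= f g -> ->.
Qed.

Lemma some_form_rformula {I : finType} (F : I -> ord.formula R) :
  (forall i, ord.rformula (F i)) -> ord.rformula (some_form F).
Proof.
by move=> rF; apply: (big_ind (fun f => is_true (ord.rformula f))) => //= f g -> ->.
Qed.

Lemma all_form_qf {I : finType} (F : I -> ord.formula R) :
  (forall i, ord.qf_form (F i)) -> ord.qf_form (all_form F).
Proof.
by move=> rF; apply: (big_ind (fun f => is_true (ord.qf_form f))) => //= f g -> ->.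
Qed.

Lemma sum_term_rterm {I : finType} (t : I -> GRing.term R) :
  (forall i, GRing.rterm (t i)) -> GRing.rterm (sum_term t).
Proof.
by move=> rt; apply: (big_ind (fun t => is_true (GRing.rterm t))) => //= s s' -> ->.
Qed.

Lemma forall_vars_rformula i m f :
  ord.rformula f -> ord.rformula (forall_vars i m f).
Proof. by move=> rf; rewrite /forall_vars; elim: (iota i m). Qed.

Lemma quantifier_free_equivalent f : ord.rformula f ->
  exists g, [/\ ord.qf_form g, ord.rformula g &
    forall e, ord.holds e f <-> ord.holds e g].
Proof.
(* [wproj] eliminates the single variable [i] from a clause [bc] of polynomial conditions, using
   that [R] is a real closed field; [ord.quantifier_elim] iterates it over the whole formula. *)
move=> rf; pose wproj i bc := qe_rcf.qfr_to_formula (@qe_rcf.wproj R i bc).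
exists (ord.quantifier_elim wproj f).
have /andP[qg rg] := ord.quantifier_elim_wf (@qe_rcf.wf_QE_wproj R) rf.
have elimP e := ord.quantifier_elim_rformP (@qe_rcf.wf_QE_wproj R)
  (@qe_rcf.valid_QE_wproj R) e rf.
(* [elimP] relates [f] to the Boolean evaluation of the eliminated formula, and [ord.qf_evalP] turns
   that evaluation back into [holds]. *)
by split=> // e; split=> [/elimP/(ord.qf_evalP _ qg)|/(ord.qf_evalP _ qg)/elimP].
Qed.

End Formulas.

(** * The formulas describing the two conditions *)

Section Descriptions.
Import ord.
Context (R : realType) (n : nat) (X : finType).

(** The enumeration order agrees with that of the payoffs in [data], so [index] in this list locates
    a payoff in the environment. *)
Definition primitive_pairs := [seq (j, x) | j <- enum 'I_n, x <- enum X].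

Definition lambda_var : GRing.term R := GRing.Var R 0.

Definition alpha_var (j : 'I_n) : GRing.term R := GRing.Var R j.+1.

Definition primitive_var (j : 'I_n) (x : X) : GRing.term R :=
  GRing.Var R (n + index (j, x) primitive_pairs).+1.

Definition data_size := (n + size primitive_pairs).+1.

(** These variables lie just past the data, where [forall_vars data_size n] quantifies. *)
Definition beta_var (j : 'I_n) : GRing.term R := GRing.Var R (data_size + j).

Definition payoff_term (a : 'I_n -> GRing.term R) (x : X) : GRing.term R :=
  sum_term (fun j => GRing.Mul (a j) (primitive_var j x)).

Definition mixed_term (t : GRing.term R) (x : X) : GRing.term R :=
  (((1 - lambda_var) * t) + lambda_var * payoff_term alpha_var x)%oT.

Definition upper_bound_body : ord.formula R :=
  (ord.Implies (all_form (fun j => 0 <=% beta_var j))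
    (ord.Implies (sum_term beta_var == 1)
      (all_form (fun x => ord.Implies
        (all_form (fun y => payoff_term beta_var y <=% payoff_term beta_var x))
        (some_form (fun y =>
          mixed_term (payoff_term beta_var x) x <=% payoff_term alpha_var y))))))%oT.

Definition upper_bound_form : ord.formula R :=
  forall_vars data_size n upper_bound_body.

(* Under the upper-bound condition, equality with [h] at an optimal action is the
   reverse inequality, that is, a conjunction over the actions. *)
Definition excludes_pure_form : ord.formula R :=
  all_form (fun j => all_form (fun x => ord.Not (ord.And
    (all_form (fun y => primitive_var j y <=% primitive_var j x))
    (all_form (fun y =>
      payoff_term alpha_var y <=% mixed_term (primitive_var j x) x)))))%oT.

End Descriptions.

(** * Evaluation of the formulas on the data *)

Section Correctness.
Context {R : realType} {n : nat} {X : finType}.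
Implicit Types (u : 'I_n -> X -> R) (lambda : R) (alpha beta : 'rV[R]_n).
Local Notation alpha_var := (@alpha_var R n).
Local Notation primitive_var := (@primitive_var R n X).
Local Notation beta_var := (@beta_var R n X).
Local Notation mixed_term := (@mixed_term R n X).
Local Notation upper_bound_body := (upper_bound_body R n X).
Local Notation upper_bound_form := (upper_bound_form R n X).
Local Notation excludes_pure_form := (excludes_pure_form R n X).

Section Evaluation.
Context (u : 'I_n -> X -> R) (lambda : R) (alpha : 'rV[R]_n) (s : seq R).
Let e := data u lambda alpha ++ s.

Lemma size_data : size (data u lambda alpha) = data_size n X.
Proof. rewrite /data_size /primitive_pairs /= size_cat size_map size_enum_ord.
by rewrite !size_allpairs. Qed.

Lemma eval_alpha_var j : GRing.eval e (alpha_var j) = alpha 0 j.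
Proof.
rewrite /= -catA nth_cat size_map size_enum_ord ltn_ord.
by rewrite (nth_map j) ?size_enum_ord // nth_ord_enum.
Qed.

Lemma eval_primitive_var j x : GRing.eval e (primitive_var j x) = u j x.
Proof.
rewrite /= -catA nth_cat size_map size_enum_ord ltnNge leq_addr /= addKn.
(* Once the payoffs are a map over the list of pairs, the entry at [index (j, x)] is the image of
   [(j, x)]. *)
have -> : [seq u k y | k <- enum 'I_n, y <- enum X] =
    [seq u p.1 p.2 | p <- primitive_pairs n X] by rewrite map_allpairs.
have jx : (j, x) \in primitive_pairs n X by apply: allpairs_f; rewrite mem_enum.
rewrite nth_cat size_map index_mem jx (nth_map (j, x)) ?index_mem //.
by rewrite nth_index.
Qed.

Lemma eval_beta_var j : GRing.eval e (beta_var j) = s`_j.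
Proof. rewrite -[LHS]/(e`_(data_size n X + j)) nth_cat size_data.
by rewrite ltnNge leq_addr /= addKn. Qed.

Lemma eval_payoff_term (a : 'I_n -> GRing.term R) beta (x : X) :
  (forall j, GRing.eval e (a j) = beta 0 j) ->
  GRing.eval e (payoff_term a x) = payoff u beta x.
Proof.
move=> ea; rewrite eval_sum_term; apply: eq_bigr => j _.
by rewrite -ea -[in RHS](eval_primitive_var j x).
Qed.

(** Keeping [t] arbitrary serves both uses: a sum over the quantified coordinates for a general
    [beta], and a single primitive variable for a vertex. *)
Lemma eval_mixed_term t beta x : GRing.eval e t = payoff u beta x ->
  GRing.eval e (mixed_term t x) = mixed_payoff u lambda alpha beta x.
Proof.
move=> et; rewrite /mixed_payoff -et -(eval_payoff_term x eval_alpha_var).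
by [].
Qed.

End Evaluation.

Lemma payoff_term_rterm (a : 'I_n -> GRing.term R) (x : X) :
  (forall j, GRing.rterm (a j)) -> GRing.rterm (payoff_term a x).
Proof. by move=> ra; apply: sum_term_rterm => j /=; rewrite ra. Qed.

Lemma mixed_term_rterm t x : GRing.rterm t -> GRing.rterm (mixed_term t x).
Proof. by move=> rt; rewrite /= rt payoff_term_rterm. Qed.

Lemma upper_bound_form_rformula : ord.rformula upper_bound_form.
Proof.
apply: forall_vars_rformula => /=; rewrite sum_term_rterm // all_form_rformula //=.
apply: all_form_rformula => x /=.
rewrite all_form_rformula => [|y] /=; last by rewrite !payoff_term_rterm.
by apply: some_form_rformula => y; rewrite /= !payoff_term_rterm.
Qed.

Lemma excludes_pure_form_qf : ord.qf_form excludes_pure_form.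
Proof.
apply: all_form_qf => j; apply: all_form_qf => x /=.
by rewrite !all_form_qf.
Qed.

Lemma excludes_pure_form_rformula : ord.rformula excludes_pure_form.
Proof.
apply: all_form_rformula => j; apply: all_form_rformula => x /=.
by rewrite !all_form_rformula //= => y; rewrite !payoff_term_rterm.
Qed.

Context (X_gt0 : (0 < #|X|)%N).

Lemma holds_upper_bound_body u lambda alpha (s : n.-tuple R) :
  let beta := \row_j s`_j in
  ord.holds (data u lambda alpha ++ s) upper_bound_body <->
  (worldviews beta -> forall x, optimal u beta x ->
     mixed_payoff u lambda alpha beta x <= best_payoff u alpha).
Proof.
move=> beta; set e := data u lambda alpha ++ s.
have evalb j : GRing.eval e (beta_var j) = beta 0 j by rewrite eval_beta_var mxE.
have payb x : GRing.eval e (payoff_term beta_var x) = payoff u beta x.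
  exact: eval_payoff_term.
have paya x : GRing.eval e (payoff_term alpha_var x) = payoff u alpha x.
  by apply: eval_payoff_term => j; exact: eval_alpha_var.
have mixb x : GRing.eval e (mixed_term (payoff_term beta_var x) x) =
    mixed_payoff u lambda alpha beta x by exact: eval_mixed_term.
have nonneg : ord.holds e
      (all_form (fun j => ord.Le (GRing.NatConst R 0) (beta_var j))) <->
    forall j, 0 <= beta 0 j.
  by rewrite holds_all_form; split=> h j; have := h j; rewrite holds_le evalb.
have sum1 : ord.holds e (ord.Equal (sum_term beta_var) (GRing.NatConst R 1)) <->
    \sum_j beta 0 j = 1.
  rewrite holds_eq eval_sum_term.
  by under eq_bigr do rewrite evalb.
have opt (x : X) : ord.holds e (all_form (fun y : X =>
      ord.Le (payoff_term beta_var y) (payoff_term beta_var x))) <->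
    optimal u beta x.
  rewrite holds_all_form optimalP.
  by split=> h y; have := h y; rewrite holds_le !payb.
have best (x : X) : ord.holds e (some_form (fun y : X =>
      ord.Le (mixed_term (payoff_term beta_var x) x) (payoff_term alpha_var y))) <->
    mixed_payoff u lambda alpha beta x <= best_payoff u alpha.
  rewrite holds_some_form exists_le_max_value //.
  by split=> -[y h]; exists y; move: h; rewrite holds_le mixb paya.
split=> [h [/nonneg b0 /sum1 b1] x /opt zx|h /nonneg b0 /sum1 b1].
  by apply/best; move: zx; exact: (iffLR (holds_all_form _ _) (h b0 b1) x).
by apply/holds_all_form => x /opt zx; apply/best/h.
Qed.

Lemma upper_bound_formP u lambda alpha :
  upper_bound u lambda alpha <->
  ord.holds (data u lambda alpha) upper_bound_form.
Proof.
rewrite /upper_bound_form -(size_data u lambda alpha) holds_forall_vars.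
split=> [ub s|h beta wb].
  by apply/holds_upper_bound_body => // wb; exact: ub.
(* Quantifying over tuples covers every worldview: the tuple of coordinates of [beta] gives back
   [beta] as a row vector. *)
have := h [tuple beta 0 j | j < n].
move/holds_upper_bound_body.
have -> : \row_j [tuple beta 0 i | i < n]`_j = beta.
  by apply/rowP => j; rewrite mxE -tnth_nth tnth_mktuple.
exact.
Qed.

Lemma excludes_pure_formP u lambda alpha : upper_bound u lambda alpha ->
  excludes_pure u lambda alpha <->
  ord.holds (data u lambda alpha) excludes_pure_form.
Proof.
(* The evaluation lemmas expect the data followed by a tail; here no variable is quantified and the
   tail is empty. *)
move=> ub; rewrite -[data _ _ _]cats0; set e := data u lambda alpha ++ [::].
have prim j x : GRing.eval e (primitive_var j x) = u j x.
  exact: eval_primitive_var.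
have paya x : GRing.eval e (payoff_term alpha_var x) = payoff u alpha x.
  by apply: eval_payoff_term => j; exact: eval_alpha_var.
have mixp j x : GRing.eval e (mixed_term (primitive_var j x) x) =
    mixed_payoff u lambda alpha (pure_worldview j) x.
  by apply: eval_mixed_term; rewrite prim payoff_pure.
have opt j (x : X) : ord.holds e (all_form (fun y : X =>
      ord.Le (primitive_var j y) (primitive_var j x))) <->
    optimal u (pure_worldview j) x.
  rewrite holds_all_form optimalP.
  by split=> h y; have := h y;
    rewrite holds_le !prim !payoff_pure.
have best j (x : X) : ord.holds e (all_form (fun y : X =>
      ord.Le (payoff_term alpha_var y) (mixed_term (primitive_var j x) x))) <->
    best_payoff u alpha <= mixed_payoff u lambda alpha (pure_worldview j) x.
  rewrite holds_all_form max_value_le //.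
  by split=> h y; have := h y; rewrite holds_le mixp paya.
split=> [ex|h j [wj [x zx eqx]]].
  apply/holds_all_form => j; apply/holds_all_form => x [/opt zx /best bx].
  have wj : worldviews (pure_worldview j : 'rV[R]_n) by exact: pure_worldview_mem.
  (* The formula supplies one inequality with [h] and [ub] the opposite one, which together put the
     vertex in the equality set. *)
  by apply: (ex j); split=> //; exists x => //; apply/eqP; rewrite eq_le ub.
move/holds_all_form/(_ j)/holds_all_form/(_ x): h; apply; split; first exact/opt.
by apply/best; rewrite eqx.
Qed.

End Correctness.

Theorem proposition4p3 (R : realType) (n : nat) (X : finType)
    (n_gt0 : (0 < n)%N) (X_gt0 : (0 < #|X|)%N) :
  (forall (u : 'I_n -> X -> R) (lambda : R) (alpha : 'rV[R]_n),
     0 < lambda < 1 -> worldviews alpha ->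
     [/\ upper_bound u lambda alpha <->
           (forall x, implementable u x ->
              (1 - lambda) * cell_max u x + lambda * payoff u alpha x <= best_payoff u alpha),
         upper_bound u lambda alpha ->
           equality_set u lambda alpha =
             \bigcup_(x in tight u lambda alpha) face u x
       & upper_bound u lambda alpha ->
           (excludes_pure u lambda alpha <->
            forall x j, tight u lambda alpha x ->
              ~ ((forall y, u j y <= u j x) /\ u j x = cell_max u x))])
  /\ finitely_described
       (fun (_ : 'I_n -> X -> R) (lambda : R) alpha =>
          0 < lambda < 1 /\ worldviews alpha)
       upper_bound
  /\ finitely_described
       (fun (u : 'I_n -> X -> R) (lambda : R) alpha =>
          [/\ 0 < lambda < 1, worldviews alpha & upper_bound u lambda alpha])
       excludes_pure.

Proof.
split=> [u lambda alpha /andP[_ lambda1] _|].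
  split; first exact: upper_boundP.
    exact: equality_set_faces.
  exact: excludes_pureP.
split.
  have [phi [qf rf eqf]] :=
    quantifier_free_equivalent (@upper_bound_form_rformula R n X).
  exists phi; split=> // u lambda alpha _.
  exact: iff_trans (upper_bound_formP X_gt0 u lambda alpha) (eqf _).
exists (excludes_pure_form R n X); split.
- exact: excludes_pure_form_qf.
- exact: excludes_pure_form_rformula.
by move=> u lambda alpha [_ _ ub]; exact: excludes_pure_formP.
Qed.
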